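(* Let $G=\mathbb{Z}_2^3$, let $F:G\times G\to\mathbb{R}^*$ be $$F(x,y)=(-1)^{x_1x_2y_3+x_1y_2x_3+y_1x_2x_3+\sum_{1\le i\le j\le 3}x_iy_j},$$ and regard the octonion algebra $\mathbb{O}=\mathbb{R}_F[G]$ as an algebra in $\mathrm{Vec}_G^{\partial F}$. There are exactly $168$ braidings $\mathcal{R}$ of $\mathrm{Vec}_G^{\partial F}$ such that $\mathbb{O}$ is an Azumaya algebra in $(\mathrm{Vec}_{G}^{\partial F},\mathcal{R})$, namely $$\mathcal{R}(x,y)=(-1)^{x_1x_2y_3+x_1y_2x_3+y_1x_2x_3+y_1y_2x_3+y_1x_2y_3+x_1y_2y_3+\sum_{i,j=1}^{3}a_{ij}x_iy_j},\qquad \forall x,y\in G,$$ with $(a_{11},a_{12},a_{13},a_{21},a_{22},a_{23},a_{31},a_{32},a_{33})$ one of the following $168$ tuples (each tuple written as a string $a_{11}a_{12}a_{13}a_{21}a_{22}a_{23}a_{31}a_{32}a_{33}$ of nine digits): 000000001, 000000010, 000000100, 000000111, 000001000, 000001011, 000001100, 000001111, 000010000, 000010011, 000010100, 000010111, 000011001, 000011010, 000011100, 000011111, 000100000, 000100001, 000100010, 000100011, 000111000, 000111001, 000111010, 000111011, 001000000, 001000010, 001000101, 001000111, 001001001, 001001011, 001001101, 001001111, 001010000, 001010010, 001010101, 001010111, 001011001, 001011011, 001011101, 001011111, 001100000, 001100001, 001100010, 001100011, 001110000, 001110001, 001110010, 001110011, 010000000, 010000001, 010000100, 010000101, 010001000,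 010001001, 010001100, 010001101, 010010010, 010010011, 010010100, 010010101, 010011010, 010011011, 010011100, 010011101, 010110000, 010110001, 010110010, 010110011, 010111000, 010111001, 010111010, 010111011, 100000000, 100000010, 100000101, 100000111, 100001000, 100001011, 100001100, 100001111, 100011010, 100011011, 100011100, 100011101, 100100010, 100100011, 100100100, 100100101, 100110000, 100110011, 100110100, 100110111, 100111000, 100111010, 100111101, 100111111, 101000001, 101000010, 101000100, 101000111, 101001001, 101001011, 101001101, 101001111, 101010010, 101010011, 101010100, 101010101, 101100010, 101100011, 101100100, 101100101, 101110001, 101110010, 101110100, 101110111, 101111001, 101111011, 101111101, 101111111, 110001000, 110001001, 110001100, 110001101, 110010000, 110010010, 110010101, 110010111, 110011001, 110011010, 110011100, 110011111, 110100000, 110100001, 110100100, 110100101, 110110001, 110110010, 110110100, 110110111, 110111000, 110111010, 110111101, 110111111, 111000000, 111000001, 111000100, 111000101, 111010000, 111010011, 111010100, 111010111, 111011001, 111011011, 111011101, 111011111, 111100000, 111100001, 111100100, 111100101, 111110000, 111110011, 111110100, 111110111, 111111001, 111111011, 111111101, 111111111.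
   Context: All vector spaces are over $\mathbb{R}$. $\mathbb{Z}_2=\{0,1\}$, $G=\mathbb{Z}_2^3$ is written additively, and $x=(x_1,x_2,x_3)$, $y=(y_1,y_2,y_3)\in G$. For a normalized 3-cocycle $\Phi:G^3\to\mathbb{R}^*$, the linear Gr-category $\mathrm{Vec}_G^{\Phi}$ is the tensor category of finite-dimensional $G$-graded real vector spaces, with the usual graded tensor product and associativity constraint $(u\otimes v)\otimes w\mapsto \Phi(x,y,z)\,u\otimes(v\otimes w)$ for $u,v,w$ homogeneous of degrees $x,y,z$. A braiding of $\mathrm{Vec}_G^\Phi$ is given by a quasi-bicharacter with respect to $\Phi$, i.e. a function $\mathcal{R}:G\times G\to\mathbb{R}^*$ with $$\mathcal{R}(x+y,z)=\mathcal{R}(x,z)\mathcal{R}(y,z)\frac{\Phi(z,x,y)\Phi(x,y,z)}{\Phi(x,z,y)},\qquad \mathcal{R}(x,y+z)=\mathcal{R}(x,y)\mathcal{R}(x,z)\frac{\Phi(y,x,z)}{\Phi(y,z,x)\Phi(x,y,z)}$$ for all $x,y,z\in G$; the braiding is $u\otimes v\mapsto \mathcal{R}(x,y)\,v\otimes u$ for $u,v$ homogeneous of degrees $x,y$. Braidings are identified with, and counted as, such functions $\mathcal{R}$. For a 2-cochain $F:G\times G\to\mathbb{R}^*$ (with $F(0,x)=F(x,0)=1$), $\partial F(x,y,z)=\dfrac{F(x,y)F(x+y,z)}{F(x,y+z)F(y,z)}$. The twisted group algebra $\mathbb{R}_F[G]$ is the real vector space with basis $G$ (the basis element $x$ having degree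 $x$) and product $x\cdot y=F(x,y)(x+y)$, where on the right $x+y$ denotes the basis element indexed by the sum. For the $F$ in the claim, the octonion algebra $\mathbb{O}$ is identified with $\mathbb{R}_F[G]$. An algebra in $\mathrm{Vec}_G^{\Phi}$ is a finite-dimensional $G$-graded space $A$ with a degree-preserving unital multiplication satisfying $(a\cdot b)\cdot c=\Phi(|a|,|b|,|c|)\,a\cdot(b\cdot c)$ for homogeneous $a,b,c$, where $|a|$ is the degree of $a$. Azumaya algebras are understood in the general sense for braided monoidal categories (Van Oystaeyen–Zhang), which in the present setting reads: a nonzero algebra $A$ in $(\mathrm{Vec}_G^{\Phi},\mathcal{R})$ is Azumaya if the two linear maps $A\otimes A\to\mathrm{End}_{\mathbb{R}}(A)$ determined on homogeneous elements by $$a\otimes b\mapsto\big(t\mapsto \Phi(|a|,|b|,|t|)\,\mathcal{R}(|b|,|t|)\;a\cdot(t\cdot b)\big),\qquad a\otimes b\mapsto\big(t\mapsto \Phi(|t|,|a|,|b|)^{-1}\,\mathcal{R}(|t|,|a|)\;(a\cdot t)\cdot b\big)$$ are both bijective (these are the canonical morphisms from $A\otimes\overline{A}$ and $\overline{A}\otimes A$ to the two internal endomorphism objects of $A$, where $\overline{A}$ is the braided opposite algebra). *)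

(* Defs.v *)
From Stdlib Require Import Ascii String.
From HB Require Import structures.
From mathcomp Require Import all_boot all_order all_algebra.
From mathcomp Require Import boolp classical_sets cardinality reals.
From mathcomp Require Import ring.

Set Implicit Arguments.
Unset Strict Implicit.
Unset Printing Implicit Defensive.

Import Order.TTheory GRing.Theory Num.Theory.
Import VectorInternalTheory.
Local Open Scope ring_scope.

(* The tensor product of two finite-dimensional spaces, in the coordinates
   carried by every [vectType]: a (x) b is the matrix of products of the
   coordinates.  [tensor_universal] is its universal property. *)
Definition tensor (K : fieldType) (V W : vectType K) : vectType K :=
  'M[K]_(dim V, dim W).

Definition tens (K : fieldType) (V W : vectType K) (a : V) (b : W) :
    tensor V W :=
  (v2r a)^T *m v2r b.

Lemma tens_linearl (K : fieldType) (V W : vectType K) (b : W) :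
  linear (fun a : V => tens a b).
Proof.
by move=> k u v; rewrite /tens !linearP /= mulmxDl -scalemxAl.
Qed.

Lemma tens_linearr (K : fieldType) (V W : vectType K) (a : V) :
  linear (fun b : W => tens a b).
Proof.
by move=> k u v; rewrite /tens !linearP.
Qed.

Lemma tensor_universal (K : fieldType) (V W U : vectType K)
    (h : V -> W -> U) :
    (forall b, linear (fun a => h a b)) -> (forall a, linear (h a)) ->
  exists! f : 'Hom(tensor V W, U), forall a b, f (tens a b) = h a b.
Proof.
move=> hl hr.
have hlin b : GRing.linear_for *:%R (fun a => h a b) by exact: hl.
pose Hl b := GRing.isLinear.Build _ _ _ _ _ (hl b).
pose hL b : {linear V -> U} := HB.pack (fun a => h a b) (Hl b).
pose Hr a := GRing.isLinear.Build _ _ _ _ _ (hr a).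
pose hR a : {linear W -> U} := HB.pack (h a) (Hr a).
pose g (M : tensor V W) : U :=
  \sum_i \sum_j M i j *: h (r2v (delta_mx 0 i)) (r2v (delta_mx 0 j)).
have glin : linear g.
  move=> k M N; rewrite /g scaler_sumr -big_split; apply: eq_bigr => i _ /=.
  rewrite scaler_sumr -big_split; apply: eq_bigr => j _ /=.
  by rewrite !mxE scalerDl scalerA.
pose Hg := GRing.isLinear.Build _ _ _ _ _ glin.
pose gL : {linear tensor V W -> U} := HB.pack g Hg.
have dec (T : vectType K) (a : T) :
    a = \sum_i v2r a 0 i *: r2v (delta_mx 0 i).
  apply: v2r_inj; rewrite linear_sum [LHS]row_sum_delta.
  by apply: eq_bigr => i _; rewrite linearZ /= r2vK.
exists (linfun gL); split.
  move=> a b; rewrite lfunE /= /g.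
  rewrite [in RHS](dec _ a) -[RHS]/(hL b _) linear_sum; apply: eq_bigr => i _.
  rewrite linearZ /= [in RHS](dec _ b) -[h _ _]/(hR _ _) linear_sum scaler_sumr.
  apply: eq_bigr => j _.
  by rewrite linearZ /= scalerA mxE big_ord1 !mxE.
move=> f Hf; apply/lfunP => M; rewrite lfunE /= /g.
rewrite [in RHS](matrix_sum_delta M) linear_sum; apply: eq_bigr => i _.
rewrite linear_sum; apply: eq_bigr => j _; rewrite linearZ /=; congr (_ *: _).
by rewrite -Hf /tens !r2vK trmx_delta mul_delta_mx.
Qed.

(* [Phi x y z] is the scalar of the associativity constraint
   (u v) w -> u (v w) in degrees x, y, z; [cocycle3P] is the pentagon axiom
   for this direction. *)
Record cocycle3 (R : realType) (G : finZmodType) := Cocycle3 {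
  cocycle3_fun :> G -> G -> G -> R;
  cocycle3_neq0 : forall x y z, cocycle3_fun x y z != 0;
  cocycle3P : forall x y z t,
    cocycle3_fun y z t * cocycle3_fun x (y + z) t * cocycle3_fun x y z =
    cocycle3_fun (x + y) z t * cocycle3_fun x y (z + t);
  cocycle3_normalized : forall x y z, [|| x == 0, y == 0 | z == 0] ->
    cocycle3_fun x y z = 1 }.

Record cochain2 (R : realType) (G : finZmodType) := Cochain2 {
  cochain2_fun :> G -> G -> R;
  cochain2_neq0 : forall x y, cochain2_fun x y != 0;
  cochain2_0x : forall x, cochain2_fun 0 x = 1;
  cochain2_x0 : forall x, cochain2_fun x 0 = 1 }.

Definition coboundary_fun (R : realType) (G : finZmodType) (F : G -> G -> R)
    (x y z : G) : R :=
  F x y * F (x + y) z / (F x (y + z) * F y z).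

Lemma coboundary_neq0 (R : realType) (G : finZmodType) (F : cochain2 R G)
  (x y z : G) : coboundary_fun F x y z != 0.
Proof. by rewrite /coboundary_fun !(mulf_neq0, invr_neq0, cochain2_neq0). Qed.

Lemma coboundaryP (R : realType) (G : finZmodType) (F : cochain2 R G)
    (x y z t : G) :
  coboundary_fun F y z t * coboundary_fun F x (y + z) t *
    coboundary_fun F x y z =
  coboundary_fun F (x + y) z t * coboundary_fun F x y (z + t).
Proof.
rewrite /coboundary_fun !addrA.
apply: (mulIf (x := F y (z + t) * F z t * (F x (y + z + t) * F (y + z) t) *
  (F x (y + z) * F y z) * (F (x + y) (z + t)))).
  by rewrite !mulf_neq0 ?cochain2_neq0.
move: (cochain2_neq0 F); set a := F y (z + t); set b := F z t => H.
have aN : a != 0 by exact: H.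
have bN : b != 0 by exact: H.
set c := F x (y + z + t); have cN : c != 0 by exact: H.
set d := F (y + z) t; have dN : d != 0 by exact: H.
set e := F x (y + z); have eN : e != 0 by exact: H.
set f := F y z; have fN : f != 0 by exact: H.
set g := F (x + y) (z + t); have gN : g != 0 by exact: H.
by field; rewrite ?aN ?bN ?cN ?dN ?eN ?fN ?gN.
Qed.

Lemma coboundary_normalized (R : realType) (G : finZmodType)
    (F : cochain2 R G) (x y z : G) :
  [|| x == 0, y == 0 | z == 0] -> coboundary_fun F x y z = 1.
Proof.
by rewrite /coboundary_fun => /or3P[]/eqP->;
  rewrite ?(add0r, addr0, cochain2_0x, cochain2_x0, mulr1, mul1r) divff
    ?cochain2_neq0.
Qed.

Definition coboundary (R : realType) (G : finZmodType) (F : cochain2 R G) :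
    cocycle3 R G :=
  Cocycle3 (coboundary_neq0 F) (coboundaryP F) (coboundary_normalized F).

Record graded_algebra (R : realType) (G : finZmodType) (Phi : cocycle3 R G) :=
  GradedAlgebra {
  carrier :> vectType R;
  degree : G -> {vspace carrier};
  degree_direct : directv (\sum_x degree x);
  degree_full : (\sum_x degree x)%VS = fullv;
  gmul : carrier -> carrier -> carrier;
  gone : carrier;
  gmul_linearl : forall b, linear (fun a => gmul a b);
  gmul_linearr : forall a, linear (gmul a);
  gmul_degree : forall x y a b, a \in degree x -> b \in degree y ->
    gmul a b \in degree (x + y);
  gone_degree : gone \in degree 0;
  gmul1a : forall a, gmul gone a = a;
  gmula1 : forall a, gmul a gone = a;
  gmulA : forall x y z a b c,
    a \in degree x -> b \in degree y -> c \in degree z ->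
    gmul (gmul a b) c = Phi x y z *: gmul a (gmul b c) }.

(* The braiding is u (x) v |-> B x y *: v (x) u in degrees x, y; the two
   equations are the hexagon axioms. *)
Definition is_braiding (R : realType) (G : finZmodType) (Phi : cocycle3 R G)
    (B : G -> G -> R) : Prop :=
  [/\ forall x y, B x y != 0,
      forall x y z, B (x + y) z =
        B x z * B y z * (Phi z x y * Phi x y z / Phi x z y) &
      forall x y z, B x (y + z) =
        B x y * B x z * (Phi y x z / (Phi y z x * Phi x y z))].

Definition left_canonical (R : realType) (G : finZmodType)
    (Phi : cocycle3 R G) (B : G -> G -> R) (A : graded_algebra Phi)
    (f : 'Hom(tensor A A, 'End(A))) : Prop :=
  forall x y z (a b t : A),
    a \in degree A x -> b \in degree A y -> t \in degree A z ->
    f (tens a b) t = (Phi x y z * B y z) *: gmul a (gmul t b).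

Definition right_canonical (R : realType) (G : finZmodType)
    (Phi : cocycle3 R G) (B : G -> G -> R) (A : graded_algebra Phi)
    (f : 'Hom(tensor A A, 'End(A))) : Prop :=
  forall x y z (a b t : A),
    a \in degree A x -> b \in degree A y -> t \in degree A z ->
    f (tens a b) t = ((Phi z x y)^-1 * B z x) *: gmul (gmul a t) b.

Lemma homogeneous_extension (R : realType) (G : finZmodType)
    (Phi : cocycle3 R G) (A : graded_algebra Phi) (k : G -> G -> G -> R)
    (h : A -> A -> A -> A) :
    (forall b t, linear (fun a => h a b t)) ->
    (forall a t, linear (fun b => h a b t)) ->
    (forall a b, linear (h a b)) ->
  exists! f : 'Hom(tensor A A, 'End(A)), forall x y z (a b t : A),
    a \in degree A x -> b \in degree A y -> t \in degree A z ->
    f (tens a b) t = k x y z *: h a b t.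
Proof.
move=> h1 h2 h3.
pose p x : 'End(A) := sumv_pi_for (esym (degree_full A)) x.
have pE a : \sum_x p x a = a.
  by apply: (sumv_pi_sum (P := xpredT)); rewrite ?degree_full ?memvf.
have pin x a : p x a \in degree A x by exact: memv_sum_pi.
have phom x a z : a \in degree A x -> p z a = if z == x then a else 0.
  move=> ax.
  have /directv_sum_unique H := degree_direct A.
  have := H (fun z => p z a) (fun z => if z == x then a else 0).
  rewrite pE -big_mkcond big_pred1_eq eqxx => /(_ (fun z _ => pin z a)) H'.
  have : forall z0, true -> (if z0 == x then a else 0) \in degree A z0.
    by move=> w _; case: eqP => [->|_] //; rewrite mem0v.
  by move=> /H' /esym /forall_inP /(_ z isT) /eqP.
pose H (a b t : A) : A :=
  \sum_x \sum_y \sum_z k x y z *: h (p x a) (p y b) (p z t).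
have H1 b t : linear (fun a => H a b t).
  move=> c u v; rewrite /H scaler_sumr -big_split; apply: eq_bigr => x _ /=.
  rewrite scaler_sumr -big_split; apply: eq_bigr => y _ /=.
  rewrite scaler_sumr -big_split; apply: eq_bigr => z _ /=.
  by rewrite linearP h1 scalerDr !scalerA (mulrC c).
have H2 a t : linear (fun b => H a b t).
  move=> c u v; rewrite /H scaler_sumr -big_split; apply: eq_bigr => x _ /=.
  rewrite scaler_sumr -big_split; apply: eq_bigr => y _ /=.
  rewrite scaler_sumr -big_split; apply: eq_bigr => z _ /=.
  by rewrite linearP h2 scalerDr !scalerA (mulrC c).
have H3 a b : linear (H a b).
  move=> c u v; rewrite /H scaler_sumr -big_split; apply: eq_bigr => x _ /=.
  rewrite scaler_sumr -big_split; apply: eq_bigr => y _ /=.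
  rewrite scaler_sumr -big_split; apply: eq_bigr => z _ /=.
  by rewrite linearP h3 scalerDr !scalerA (mulrC c).
pose m a b := GRing.isLinear.Build _ _ _ _ _ (H3 a b).
pose HL a b : {linear A -> A} := HB.pack (H a b) (m a b).
pose HH (a b : A) : 'End(A) := linfun (HL a b).
have [||f [Hf fU]] := @tensor_universal _ _ _ _ HH.
- by move=> b c u v; apply/lfunP => t; rewrite add_lfunE scale_lfunE !lfunE /= H1.
- by move=> a c u v; apply/lfunP => t; rewrite add_lfunE scale_lfunE !lfunE /= H2.
have h10 b t : h 0 b t = 0.
  by have := h1 b t (-1) 0 0; rewrite scaler0 addr0 scaleN1r addNr.
have h20 a t : h a 0 t = 0.
  by have := h2 a t (-1) 0 0; rewrite scaler0 addr0 scaleN1r addNr.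
have h30 a b : h a b 0 = 0.
  by have := h3 a b (-1) 0 0; rewrite scaler0 addr0 scaleN1r addNr.
exists f; split.
  move=> x y z a b t ax by_ tz; rewrite Hf lfunE /= /H.
  rewrite (bigD1 x) //= [X in _ + X]big1 ?addr0; last first.
    move=> x' /negPf nx; rewrite big1 // => y' _; rewrite big1 // => z' _.
    by rewrite (phom _ _ _ ax) nx h10 scaler0.
  rewrite (bigD1 y) //= [X in _ + X]big1 ?addr0; last first.
    move=> y' /negPf ny; rewrite big1 // => z' _.
    by rewrite (phom _ _ _ by_) ny h20 scaler0.
  rewrite (bigD1 z) //= [X in _ + X]big1 ?addr0; last first.
    by move=> z' /negPf nz; rewrite (phom _ _ _ tz) nz h30 scaler0.
  by rewrite (phom _ _ _ ax) (phom _ _ _ by_) (phom _ _ _ tz) !eqxx.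
move=> g Hg; apply: fU => a b; apply/lfunP => t; rewrite lfunE /=.
pose Ll b := GRing.isLinear.Build _ _ _ _ _ (@tens_linearl _ A A b).
pose tL b : {linear A -> tensor A A} := HB.pack (fun a => tens a b) (Ll b).
pose Lr a := GRing.isLinear.Build _ _ _ _ _ (@tens_linearr _ A A a).
pose tR a : {linear A -> tensor A A} := HB.pack (fun b => tens a b) (Lr a).
rewrite /H -[in LHS](pE a) -[tens _ _]/(tL b _) !linear_sum sum_lfunE.
apply: eq_bigr => x _; rewrite /= -[in LHS](pE b) -[tens _ _]/(tR _ _).
rewrite !linear_sum sum_lfunE; apply: eq_bigr => y _ /=.
rewrite -[in LHS](pE t) linear_sum; apply: eq_bigr => z _.
exact: Hg.
Qed.

Lemma left_canonical_unique (R : realType) (G : finZmodType)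
    (Phi : cocycle3 R G) (B : G -> G -> R) (A : graded_algebra Phi) :
  exists! f, @left_canonical R G Phi B A f.
Proof.
apply: (@homogeneous_extension _ _ _ A (fun x y z => Phi x y z * B y z)
  (fun a b t => gmul a (gmul t b))) => [b t|a t|a b] c u v.
- exact: gmul_linearl.
- by rewrite gmul_linearr gmul_linearr.
- by rewrite gmul_linearl gmul_linearr.
Qed.

Lemma right_canonical_unique (R : realType) (G : finZmodType)
    (Phi : cocycle3 R G) (B : G -> G -> R) (A : graded_algebra Phi) :
  exists! f, @right_canonical R G Phi B A f.
Proof.
apply: (@homogeneous_extension _ _ _ A (fun x y z => (Phi z x y)^-1 * B z x)
  (fun a b t => gmul (gmul a t) b)) => [b t|a t|a b] c u v.
- by rewrite gmul_linearl gmul_linearl.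
- exact: gmul_linearr.
- by rewrite gmul_linearr gmul_linearl.
Qed.

(* By [left_canonical_unique] and [right_canonical_unique] the conditions on
   homogeneous elements determine exactly one map on each side, so the
   existential quantifiers below range over that single map. *)
Definition azumaya (R : realType) (G : finZmodType) (Phi : cocycle3 R G)
    (B : G -> G -> R) (A : graded_algebra Phi) : Prop :=
  [/\ (fullv : {vspace A}) != 0%VS,
      exists2 f : 'Hom(tensor A A, 'End(A)),
        left_canonical B f & bijective f &
      exists2 f : 'Hom(tensor A A, 'End(A)),
        right_canonical B f & bijective f].

Definition group_space (R : realType) (G : finZmodType) : vectType R :=
  {ffun G -> R^o}.

Definition group_basis (R : realType) (G : finZmodType) (x : G) :
    group_space R G :=
  [ffun y => (y == x)%:R].

Definition twisted_mul (R : realType) (G : finZmodType) (F : G -> G -> R)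
    (u v : group_space R G) : group_space R G :=
  \sum_x \sum_y (u x * v y * F x y) *: group_basis R (x + y).

Definition twisted_degree (R : realType) (G : finZmodType) (x : G) :
    {vspace group_space R G} :=
  <[group_basis R x]>%VS.

Lemma twisted_mul_basis (R : realType) (G : finZmodType) (F : G -> G -> R)
    (x y : G) :
  twisted_mul F (group_basis R x) (group_basis R y) =
  F x y *: group_basis R (x + y).
Proof.
rewrite /twisted_mul (bigD1 x) //= [X in _ + X]big1 ?addr0; last first.
  by move=> z /negPf nz; rewrite big1 // => t _; rewrite ffunE nz !mul0r scale0r.
rewrite (bigD1 y) //= [X in _ + X]big1 ?addr0; last first.
  by move=> z /negPf nz; rewrite [X in _ * X * _]ffunE nz mulr0 mul0r scale0r.
by rewrite !ffunE !eqxx !mul1r.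
Qed.

Lemma group_basis_sum (R : realType) (G : finZmodType)
    (u : group_space R G) :
  u = \sum_x u x *: group_basis R x.
Proof.
apply/ffunP => y; rewrite sum_ffunE (bigD1 y) //= big1 ?addr0.
  by rewrite !ffunE eqxx [_ *: _]mulr1.
by move=> x /negPf nx; rewrite !ffunE eq_sym nx [_ *: _]mulr0.
Qed.

Lemma twisted_degree_full (R : realType) (G : finZmodType) :
  (\sum_(x : G) twisted_degree R x)%VS = fullv.
Proof.
apply/eqP; rewrite eqEsubv subvf; apply/subvP => u _.
rewrite [u]group_basis_sum; apply: memv_sumr => x _.
by rewrite memvZ // memv_line.
Qed.

Lemma twisted_degree_direct (R : realType) (G : finZmodType) :
  directv (\sum_(x : G) twisted_degree R x).
Proof.
apply/directv_sum_independent => us uin us0 x _.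
have /ffunP/(_ x) := us0; rewrite sum_ffunE (bigD1 x) //= big1 ?addr0.
  have /vlineP[c ->] := uin x isT.
  rewrite !ffunE eqxx => /eqP; rewrite [_ *: _]mulr1 => /eqP->.
  by rewrite scale0r.
move=> y /negPf ny; have /vlineP[c ->] := uin y isT.
by rewrite !ffunE eq_sym ny [_ *: _]mulr0.
Qed.

Lemma twisted_mul_linearl (R : realType) (G : finZmodType) (F : G -> G -> R)
    (v : group_space R G) : linear (fun u => twisted_mul F u v).
Proof.
move=> k u w; rewrite /twisted_mul scaler_sumr -big_split.
apply: eq_bigr => x _ /=; rewrite scaler_sumr -big_split.
apply: eq_bigr => y _ /=.
by rewrite !ffunE scalerA -scalerDl !mulrDl -!mulrA.
Qed.

Lemma twisted_mul_linearr (R : realType) (G : finZmodType) (F : G -> G -> R)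
    (u : group_space R G) : linear (twisted_mul F u).
Proof.
move=> k v w; rewrite /twisted_mul scaler_sumr -big_split.
apply: eq_bigr => x _ /=; rewrite scaler_sumr -big_split.
apply: eq_bigr => y _ /=.
rewrite !ffunE scalerA -scalerDl mulrDr !mulrDl; congr ((_ + _) *: _).
by rewrite [_ *: _]/(_ * _) mulrCA !mulrA.
Qed.

Lemma twisted_mulZ (R : realType) (G : finZmodType) (F : G -> G -> R)
    (c d : R) (u v : group_space R G) :
  twisted_mul F (c *: u) (d *: v) = (c * d) *: twisted_mul F u v.
Proof.
rewrite /twisted_mul scaler_sumr; apply: eq_bigr => x _.
rewrite scaler_sumr; apply: eq_bigr => y _; rewrite !ffunE scalerA.
rewrite ![_ *: _ : R^o]/(_ * _); congr (_ *: _).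
by rewrite mulrACA !mulrA.
Qed.

Lemma twisted_mul_degree (R : realType) (G : finZmodType) (F : G -> G -> R)
    (x y : G) (a b : group_space R G) :
  a \in twisted_degree R x -> b \in twisted_degree R y ->
  twisted_mul F a b \in twisted_degree R (x + y).
Proof.
move=> /vlineP[c ->] /vlineP[d ->].
by rewrite twisted_mulZ twisted_mul_basis !memvZ ?memv_line.
Qed.

Lemma twisted_mul1a (R : realType) (G : finZmodType) (F : cochain2 R G)
    (a : group_space R G) : twisted_mul F (group_basis R 0) a = a.
Proof.
rewrite [RHS]group_basis_sum /twisted_mul (bigD1 0) //= [X in _ + X]big1.
  rewrite addr0; apply: eq_bigr => y _.
  by rewrite ffunE eqxx mul1r cochain2_0x mulr1 add0r.
by move=> x /negPf nx; rewrite big1 // => y _; rewrite ffunE nx !mul0r scale0r.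
Qed.

Lemma twisted_mula1 (R : realType) (G : finZmodType) (F : cochain2 R G)
    (a : group_space R G) : twisted_mul F a (group_basis R 0) = a.
Proof.
rewrite [RHS]group_basis_sum /twisted_mul; apply: eq_bigr => x _.
rewrite (bigD1 0) //= [X in _ + X]big1.
  by rewrite addr0 ffunE eqxx mulr1 cochain2_x0 mulr1 addr0.
by move=> y /negPf ny; rewrite [X in _ * X * _]ffunE ny mulr0 mul0r scale0r.
Qed.

Lemma twisted_mulA (R : realType) (G : finZmodType) (F : cochain2 R G)
    (x y z : G) (a b c : group_space R G) :
  a \in twisted_degree R x -> b \in twisted_degree R y ->
  c \in twisted_degree R z ->
  twisted_mul F (twisted_mul F a b) c =
  coboundary F x y z *: twisted_mul F a (twisted_mul F b c).
Proof.
move=> /vlineP[p ->] /vlineP[q ->] /vlineP[r ->].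
have Zl k u v : twisted_mul F (k *: u) v = k *: twisted_mul F u v.
  by rewrite -[v in LHS]scale1r twisted_mulZ mulr1.
have Zr k u v : twisted_mul F u (k *: v) = k *: twisted_mul F u v.
  by rewrite -[u in LHS]scale1r twisted_mulZ mul1r.
rewrite !(Zl, Zr, twisted_mul_basis) !scalerA addrA; congr (_ *: _).
rewrite /coboundary /= /coboundary_fun.
have := cochain2_neq0 F x (y + z); have := cochain2_neq0 F y z.
set s := F x (y + z); set t := F y z => t0 s0.
by field; rewrite s0 t0.
Qed.

Definition twisted_group_algebra (R : realType) (G : finZmodType)
    (F : cochain2 R G) : graded_algebra (coboundary F) :=
  @GradedAlgebra R G (coboundary F) (group_space R G)
    (@twisted_degree R G) (twisted_degree_direct R G)
    (twisted_degree_full R G) (twisted_mul F) (group_basis R 0)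
    (@twisted_mul_linearl R G F) (@twisted_mul_linearr R G F)
    (@twisted_mul_degree R G F) (memv_line _)
    (twisted_mul1a F) (twisted_mula1 F) (@twisted_mulA R G F).

Definition Z2_3 : finZmodType := 'rV['Z_2]_3.

(* The coordinates x_1, x_2, x_3 as natural numbers 0 or 1, to be used in
   exponents of -1. *)
Definition crd (x : Z2_3) (i : 'I_3) : nat := x ord0 i.

Definition i1 : 'I_3 := @Ordinal 3 0 isT.
Definition i2 : 'I_3 := @Ordinal 3 1 isT.
Definition i3 : 'I_3 := @Ordinal 3 2 isT.

Definition octonion_exponent (x y : Z2_3) : nat :=
  (crd x i1 * crd x i2 * crd y i3 + crd x i1 * crd y i2 * crd x i3
   + crd y i1 * crd x i2 * crd x i3
   + \sum_(i < 3) \sum_(j < 3 | i <= j) crd x i * crd y j)%N.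

Definition octonion_sign (R : realType) (x y : Z2_3) : R :=
  (-1) ^+ octonion_exponent x y.

Lemma crd0 (i : 'I_3) : crd 0 i = 0%N.
Proof. by rewrite /crd mxE. Qed.

Lemma octonion_sign_neq0 (R : realType) (x y : Z2_3) :
  octonion_sign R x y != 0.
Proof. by rewrite /octonion_sign signr_eq0. Qed.

Lemma octonion_sign_0x (R : realType) (x : Z2_3) : octonion_sign R 0 x = 1.
Proof.
rewrite /octonion_sign /octonion_exponent !crd0 !(mul0n, muln0) !add0n.
by rewrite big1 // => i _; rewrite big1 // => j _; rewrite crd0.
Qed.

Lemma octonion_sign_x0 (R : realType) (x : Z2_3) : octonion_sign R x 0 = 1.
Proof.
rewrite /octonion_sign /octonion_exponent !crd0 !(mul0n, muln0) !add0n.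
by rewrite big1 // => i _; rewrite big1 // => j _; rewrite crd0 muln0.
Qed.

Definition octonion_cochain (R : realType) : cochain2 R Z2_3 :=
  Cochain2 (octonion_sign_neq0 R) (octonion_sign_0x R) (octonion_sign_x0 R).

Definition octonions (R : realType) :
    graded_algebra (coboundary (octonion_cochain R)) :=
  twisted_group_algebra (octonion_cochain R).

(* The digits a_11 a_12 a_13 a_21 a_22 a_23 a_31 a_32 a_33 of a string; with
   indices starting from 0, a_ij is the digit of index 3 i + j. *)
Definition string_coef (s : string) (i j : 'I_3) : nat :=
  if String.get (3 * i + j)%N s is Some c then (Ascii.eqb c "1"%char : bool)
  else 0%N.

Definition braiding_exponent (a : 'I_3 -> 'I_3 -> nat) (x y : Z2_3) : nat :=
  (crd x i1 * crd x i2 * crd y i3 + crd x i1 * crd y i2 * crd x i3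
   + crd y i1 * crd x i2 * crd x i3 + crd y i1 * crd y i2 * crd x i3
   + crd y i1 * crd x i2 * crd y i3 + crd x i1 * crd y i2 * crd y i3
   + \sum_(i < 3) \sum_(j < 3) a i j * crd x i * crd y j)%N.

Definition octonion_braiding (R : realType) (s : string) (x y : Z2_3) : R :=
  (-1) ^+ braiding_exponent (string_coef s) x y.

Definition azumaya_strings : list string :=
  [::
    "000000001"; "000000010"; "000000100"; "000000111"; "000001000"; "000001011";
    "000001100"; "000001111"; "000010000"; "000010011"; "000010100"; "000010111";
    "000011001"; "000011010"; "000011100"; "000011111"; "000100000"; "000100001";
    "000100010"; "000100011"; "000111000"; "000111001"; "000111010"; "000111011";
    "001000000"; "001000010"; "001000101"; "001000111"; "001001001"; "001001011";
    "001001101"; "001001111"; "001010000"; "001010010"; "001010101"; "001010111";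
    "001011001"; "001011011"; "001011101"; "001011111"; "001100000"; "001100001";
    "001100010"; "001100011"; "001110000"; "001110001"; "001110010"; "001110011";
    "010000000"; "010000001"; "010000100"; "010000101"; "010001000"; "010001001";
    "010001100"; "010001101"; "010010010"; "010010011"; "010010100"; "010010101";
    "010011010"; "010011011"; "010011100"; "010011101"; "010110000"; "010110001";
    "010110010"; "010110011"; "010111000"; "010111001"; "010111010"; "010111011";
    "100000000"; "100000010"; "100000101"; "100000111"; "100001000"; "100001011";
    "100001100"; "100001111"; "100011010"; "100011011"; "100011100"; "100011101";
    "100100010"; "100100011"; "100100100"; "100100101"; "100110000"; "100110011";
    "100110100"; "100110111"; "100111000"; "100111010"; "100111101"; "100111111";
    "101000001"; "101000010"; "101000100"; "101000111"; "101001001"; "101001011";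
    "101001101"; "101001111"; "101010010"; "101010011"; "101010100"; "101010101";
    "101100010"; "101100011"; "101100100"; "101100101"; "101110001"; "101110010";
    "101110100"; "101110111"; "101111001"; "101111011"; "101111101"; "101111111";
    "110001000"; "110001001"; "110001100"; "110001101"; "110010000"; "110010010";
    "110010101"; "110010111"; "110011001"; "110011010"; "110011100"; "110011111";
    "110100000"; "110100001"; "110100100"; "110100101"; "110110001"; "110110010";
    "110110100"; "110110111"; "110111000"; "110111010"; "110111101"; "110111111";
    "111000000"; "111000001"; "111000100"; "111000101"; "111010000"; "111010011";
    "111010100"; "111010111"; "111011001"; "111011011"; "111011101"; "111011111";
    "111100000"; "111100001"; "111100100"; "111100101"; "111110000"; "111110011";
    "111110100"; "111110111"; "111111001"; "111111011"; "111111101"; "111111111"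
  ]%string.

(* Main.v *)
(* Since [F x y / F y x] satisfies the hexagon equations for the associator
   [coboundary F], the braidings are exactly the products of this function
   with the bicharacters [N] of the group.  On basis elements both canonical
   maps are, up to nonzero factors depending only on the degrees (x, y) of
   the argument and on (x + y, t), given by the entries of [N].  If both
   radicals of [N] are trivial, orthogonality of characters makes the
   canonical maps surjective, hence bijective by dimension; conversely an
   element [y] of a radical identifies, up to a scalar, the images of the
   tensors attached to [y] and to 0.  For Z_2^3 a bicharacter is
   [(-1)^(x A y^T)] with [A] a 3 x 3 matrix over F_2, so that the Azumaya
   braidings correspond to the 168 elements of GL_3(F_2). *)
Require Import Defs.
From Stdlib Require Import String.
From mathcomp Require Import all_boot all_order all_algebra.
From mathcomp Require Import boolp classical_sets cardinality reals.
From mathcomp Require Import ring.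

Set Implicit Arguments.
Unset Strict Implicit.
Unset Printing Implicit Defensive.

Import Order.TTheory GRing.Theory Num.Theory.
Local Open Scope ring_scope.

(** * Bicharacters and the braidings for a coboundary associator *)

Definition bicharacter (R : realType) (G : finZmodType) (N : G -> G -> R) :=
  [/\ forall x y, N x y != 0,
      forall x y z, N (x + y) z = N x z * N y z &
      forall x y z, N x (y + z) = N x y * N x z].

(** For [N = 1] this is the braiding that makes the twisted group algebra commutative: swapping the
    basis elements [x] and [y] in a product costs exactly [F x y / F y x]. *)
Definition commutator_twist (R : realType) (G : finZmodType)
    (F N : G -> G -> R) (x y : G) : R :=
  N x y * (F x y / F y x).

Lemma is_braiding_twist (R : realType) (G : finZmodType) (F : cochain2 R G)
    (N : G -> G -> R) :
  is_braiding (coboundary F) (commutator_twist F N) <-> bicharacter N.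
Proof.
have F0 := cochain2_neq0 F.
have twl x y z : F (x + y) z / F z (x + y) =
    F x z / F z x * (F y z / F z y) *
    (coboundary F z x y * coboundary F x y z / coboundary F x z y).
  rewrite /= /coboundary_fun (addrC z x) (addrC z y).
  by field; rewrite !F0.
have twr x y z : F x (y + z) / F (y + z) x =
    F x y / F y x * (F x z / F z x) *
    (coboundary F y x z / (coboundary F y z x * coboundary F x y z)).
  rewrite /= /coboundary_fun (addrC x z) (addrC x y).
  by field; rewrite !F0.
have c0 x y : F x y / F y x != 0 by rewrite mulf_neq0 ?invr_neq0.
split=> -[N0 Nl Nr]; split.
- by move=> x y; have := N0 x y; rewrite mulf_eq0 negb_or => /andP[].
- move=> x y z; apply: (mulIf (c0 (x + y) z)).
  rewrite -[LHS]/(commutator_twist F N (x + y) z) Nl twl /commutator_twist.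
  by ring.
- move=> x y z; apply: (mulIf (c0 x (y + z))).
  rewrite -[LHS]/(commutator_twist F N x (y + z)) Nr twr /commutator_twist.
  by ring.
- by move=> x y; rewrite mulf_neq0.
- move=> x y z; rewrite /commutator_twist Nl twl; ring.
- move=> x y z; rewrite /commutator_twist Nr twr; ring.
Qed.

Lemma bicharacter0x (R : realType) (G : finZmodType) (N : G -> G -> R) y :
  bicharacter N -> N 0 y = 1.
Proof.
case=> N0 Nl _; apply: (mulIf (N0 0 y)).
by rewrite -Nl addr0 mul1r.
Qed.

Lemma bicharacterC (R : realType) (G : finZmodType) (N : G -> G -> R) :
  bicharacter N -> bicharacter (fun x y => N y x).
Proof. by case=> N0 Nl Nr; split. Qed.

(** Translating the summation variable by [y0] multiplies the sum by [N y0 (s - t)]; for [s != t]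
    the trivial radical supplies a [y0] where this factor is not 1, so the sum vanishes. *)
Lemma bicharacter_orthogonal (R : realType) (G : finZmodType)
    (N : G -> G -> R) (s t : G) : bicharacter N ->
  (forall s, (forall y, N y s = 1) -> s = 0) ->
  \sum_y (N y t)^-1 * N y s = #|G|%:R * (s == t)%:R.
Proof.
move=> Nb rad; have [N0 Nl Nr] := Nb.
have Nq y : (N y t)^-1 * N y s = N y (s - t).
  apply: (mulfI (N0 y t)).
  by rewrite mulrA mulfV // mul1r -Nr addrC subrK.
under eq_bigr do rewrite Nq.
have [->|nst] := eqVneq s t.
  rewrite subrr; under eq_bigr => y _.
    rewrite (bicharacter0x y (bicharacterC Nb)).
    over.
  by rewrite big_const iter_addr_0 mulr1.
rewrite mulr0; have [y0 Ny0] : exists y0, N y0 (s - t) != 1.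
  apply/existsP; rewrite -negb_forall; apply/negP => /forallP H.
  move/eqP: nst; apply; apply/eqP; rewrite -subr_eq0; apply/eqP.
  by apply: rad => y; apply/eqP.
have E : \sum_y N y (s - t) = N y0 (s - t) * \sum_y N y (s - t).
  rewrite mulr_sumr (reindex_inj (addrI y0)).
  by apply: eq_bigr => y _; rewrite Nl.
apply/eqP; move/eqP: E; rewrite -subr_eq0 -{1}[\sum_y _]mul1r -mulrBl mulf_eq0.
by rewrite subr_eq0 eq_sym (negPf Ny0).
Qed.

(** * Bijectivity of the canonical maps of a twisted group algebra *)

Section CanonicalMaps.
Variables (R : realType) (G : finZmodType) (F : cochain2 R G).
Let A := twisted_group_algebra F.
Let e (x : G) : A := group_basis R x.

Let basisE (a : A) : a = \sum_x (a : group_space R G) x *: e x.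
Proof. exact: group_basis_sum. Qed.

Let hom_sumE (f : 'Hom(tensor A A, 'End(A))) (c : G -> R)
    (w : G -> tensor A A) (a : A) :
  f (\sum_i c i *: w i) a = \sum_i c i *: f (w i) a.
Proof.
rewrite linear_sum sum_lfunE; apply: eq_bigr => i _.
by rewrite linearZ scale_lfunE.
Qed.

Let lfun_eq_basis (g h : 'End(A)) : (forall s, g (e s) = h (e s)) -> g = h.
Proof.
move=> gh; apply/lfunP => a; rewrite [a]basisE [LHS]linear_sum [RHS]linear_sum.
by apply: eq_bigr => s _; rewrite [LHS]linearZ [RHS]linearZ /= gh.
Qed.

(** The coordinate functional induced by [a x * b y] sends the left side to [c], and the right side
    to 0 unless the indices agree. *)
Lemma tens_group_basis_inj (c c' : R) (x x' y y' : G) : c != 0 ->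
  c *: tens (e x) (e y) = c' *: tens (e x') (e y') -> x = x' /\ y = y'.
Proof.
move=> c0 E.
have [||h [Hh _]] := @tensor_universal R A A R^o (fun a b => a x * b y).
- by move=> b k u v; rewrite !ffunE mulrDl -!mulrA.
- by move=> a k u v; rewrite !ffunE mulrDr; congr (_ + _); rewrite mulrCA.
have := congr1 h E; rewrite !linearZ /= !Hh !ffunE !eqxx.
have [->|nx] := eqVneq x x'; have [->|ny] := eqVneq y y' => //=;
  by rewrite ?(mulr0, mul0r, mulr1) => /eqP;
    rewrite [_ *: _]mulr1 [_ *: _]mulr0 (negPf c0).
Qed.

(* The endomorphisms [e s |-> (s == t) e (d + s)] span [End(A)], which has the
   dimension of [tensor A A]. *)
Lemma bijective_of_elementary (f : 'Hom(tensor A A, 'End(A))) :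
  (forall d t, exists w, forall s, f w (e s) = (s == t)%:R *: e (d + s)) ->
  bijective f.
Proof.
move=> H.
have surj g : exists w, f w = g.
  have /choice[T HT] : forall t, exists w, forall s,
      f w (e s) = (s == t)%:R *: g (e t).
    move=> t; have /choice[W HW] := H^~ t.
    (* The shift by [z - t] carries [e t] to [e z], so weighting by the coordinates of [g (e t)]
       rebuilds this vector. *)
    exists (\sum_z (g (e t) : group_space R G) z *: W (z - t)) => s.
    rewrite hom_sumE; under eq_bigr do rewrite HW scalerA mulrC -scalerA.
    rewrite -scaler_sumr; have [->|_] := eqVneq s t; last by rewrite !scale0r.
    rewrite [in RHS](basisE (g (e t))); congr (_ *: _); apply: eq_bigr => z _.
    by rewrite subrK.
  exists (\sum_t 1 *: T t); apply: lfun_eq_basis => s.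
  rewrite hom_sumE (bigD1 s) //= [X in _ + X]big1 ?addr0.
    by rewrite HT eqxx !scale1r.
  by move=> t /negPf nt; rewrite HT eq_sym nt scale0r scaler0.
have limgf : limg f = fullv.
  apply/eqP; rewrite eqEsubv subvf; apply/subvP => g _.
  by have [w <-] := surj g; rewrite memv_img ?memvf.
have lker0 : lker f == 0%VS.
  rewrite -dimv_eq0 -(eqn_add2r (\dim (limg f))).
  rewrite -{1}(capfv (lker f)) limg_ker_dim limgf !dimvf.
  by rewrite /tensor /= !dim_matrix.
have inj : injective f by apply/lker0P.
have /choice[g Hg] := surj.
by exists g => [w|//]; apply: inj; rewrite Hg.
Qed.

(* [tensor A A] is indexed by a total degree [d] and one more parameter [y];
   the left canonical map uses [(l d y, r d y) = (d - y, y)], the right one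
   [(y, d - y)]. *)
Variables (f : 'Hom(tensor A A, 'End(A))) (l r : G -> G -> G).
Variables (p q K : G -> G -> R).
Hypothesis p0 : forall d y, p d y != 0.
Hypothesis q0 : forall d y, q d y != 0.
Hypothesis f_basis : forall d y s,
  f (tens (e (l d y)) (e (r d y))) (e s) =
  (p d y * q d s * K y s) *: e (d + s).
Hypothesis bK : bicharacter K.

Lemma canonical_bijective : (forall s, (forall y, K y s = 1) -> s = 0) ->
  bijective f.
Proof.
move=> rad; apply: bijective_of_elementary => d t.
have G0 : #|G|%:R != 0 :> R.
  by rewrite pnatr_eq0 -lt0n; apply/card_gt0P; exists 0.
(* Fourier inversion in [y]: the weights [(K y t)^-1] isolate [s = t], and the denominator removes
   the remaining scalars. *)
exists (\sum_y ((K y t)^-1 / (p d y * q d t * #|G|%:R)) *: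
          tens (e (l d y)) (e (r d y))) => s.
rewrite hom_sumE; under eq_bigr => y _.
  rewrite f_basis scalerA.
  have -> : (K y t)^-1 / (p d y * q d t * #|G|%:R) *
      (p d y * q d s * K y s) =
      q d s / (q d t * #|G|%:R) * ((K y t)^-1 * K y s).
    by have [K0 _ _] := bK; field; rewrite !(p0, q0, G0, K0).
  over.
rewrite -scaler_suml -mulr_sumr (bicharacter_orthogonal _ _ bK rad).
have [->|_] := eqVneq s t; last by rewrite !mulr0.
by congr (_ *: _); field; rewrite q0 G0.
Qed.

Lemma canonical_radical (y : G) : injective (fun y => (l 0 y, r 0 y)) ->
  bijective f -> (forall s, K y s = 1) -> y = 0.
Proof.
move=> lr_inj /bij_inj finj Ky.
suff [] : l 0 y = l 0 0 /\ r 0 y = r 0 0.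
  by move=> El Er; apply: lr_inj; rewrite El Er.
(* With these scalars both tensors have the image [e s |-> q 0 s *: e s], because [K y s] and
   [K 0 s] are both 1. *)
apply: (tens_group_basis_inj (c := (p 0 y)^-1) (c' := (p 0 0)^-1)).
  by rewrite invr_neq0.
apply: finj; apply: lfun_eq_basis => s.
rewrite [in LHS]linearZ [in RHS]linearZ !scale_lfunE !f_basis !scalerA.
by rewrite Ky (bicharacter0x _ bK) !mulrA !mulVf.
Qed.

End CanonicalMaps.

(** The left canonical map is governed by [K = N] and the right one by its transpose, so the two
    maps exchange the roles of the two radicals. *)
Lemma azumaya_twist (R : realType) (G : finZmodType) (F : cochain2 R G)
    (N : G -> G -> R) : bicharacter N ->
  azumaya (commutator_twist F N) (twisted_group_algebra F) <->
  (forall y, (forall t, N y t = 1) -> y = 0) /\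
  (forall t, (forall y, N y t = 1) -> t = 0).
Proof.
move=> Nb; have F0 := cochain2_neq0 F; have [N0 _ _] := Nb.
set A := twisted_group_algebra F; set B := commutator_twist F N.
pose e x : A := group_basis R x.
have e_deg x : e x \in degree A x by exact: memv_line.
have mulE x y : gmul (e x) (e y) = F x y *: e (x + y).
  exact: twisted_mul_basis.
have mulZl k (u v : A) : gmul (k *: u) v = k *: gmul u v.
  by rewrite -[k in RHS]mulr1 -[v in LHS]scale1r; exact: twisted_mulZ.
have mulZr k (u v : A) : gmul u (k *: v) = k *: gmul u v.
  by rewrite -[k in RHS]mul1r -[u in LHS]scale1r; exact: twisted_mulZ.
(* The associator, the twist and the two products cancel down to one factor in [(d, y)], one in
   [(d, s)], and [N y s]. *)
have leftE f : left_canonical B f -> forall d y s,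
    f (tens (e (d - y)) (e y)) (e s) =
    (F (d - y) y * F d s * N y s) *: e (d + s).
  move=> Hf d y s; rewrite (Hf (d - y) y s) //.
  rewrite mulE mulZr mulE !scalerA (addrC s) addrA subrK; congr (_ *: _).
  rewrite /B /commutator_twist /= /coboundary_fun subrK.
  by field; rewrite !F0.
have rightE f : right_canonical B f -> forall d x s,
    f (tens (e x) (e (d - x))) (e s) =
    (F x (d - x) * F s d * N s x) *: e (d + s).
  move=> Hf d x s; rewrite (Hf x (d - x) s) //.
  rewrite mulE mulZl mulE !scalerA (addrC x s) -addrA.
  rewrite [x + (d - x)]addrC subrK (addrC s d).
  congr (_ *: _).
  rewrite /B /commutator_twist /= /coboundary_fun [x + (d - x)]addrC subrK.
  by field; rewrite !F0.
have A0 : (fullv : {vspace A}) != 0%VS.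
  apply/negP => /eqP E; have : e 0 \in (fullv : {vspace A}) by rewrite memvf.
  rewrite E memv0 => /eqP/ffunP/(_ 0); rewrite !ffunE eqxx => /eqP.
  by rewrite oner_eq0.
have [f [fc _]] := @left_canonical_unique _ _ _ B A.
have [g [gc _]] := @right_canonical_unique _ _ _ B A.
have Lbij := @canonical_bijective _ _ F f (fun d y => d - y) (fun _ => id)
  (fun d y => F (d - y) y) F N (fun _ _ => F0 _ _) F0 (leftE f fc) Nb.
have Rbij := @canonical_bijective _ _ F g (fun _ => id) (fun d x => d - x)
  (fun d x => F x (d - x)) (fun d s => F s d) (fun x s => N s x)
  (fun _ _ => F0 _ _) (fun _ _ => F0 _ _) (rightE g gc) (bicharacterC Nb).
split=> [[_ [f' fc' fb] [g' gc' gb]]|[radl radr]]; last first.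
  by split=> //; [exists f => //; exact: Lbij | exists g => //; exact: Rbij].
split=> y.
- apply: (@canonical_radical _ _ F f' (fun d y => d - y) (fun _ => id)
    (fun d y => F (d - y) y) F N (fun _ _ => F0 _ _) (leftE f' fc') Nb) => //.
  by move=> u v [].
- apply: (@canonical_radical _ _ F g' (fun _ => id) (fun d x => d - x)
    (fun d x => F x (d - x)) (fun d s => F s d) (fun x s => N s x)
    (fun _ _ => F0 _ _) (rightE g' gc') (bicharacterC Nb)) => //.
  by move=> u v [].
Qed.

(** * Bicharacters of [Z2_3] as bilinear forms over ['F_2] *)

Lemma F2_cases (u : 'F_2) : u = 0 \/ u = 1.
Proof. by case: u => [[|[|//]] iu]; [left|right]; apply: val_inj. Qed.

Section Sign.
Variable R : realType.

Definition F2_sign (u : 'F_2) : R := (-1) ^+ u.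

Lemma F2_signD u v : F2_sign (u + v) = F2_sign u * F2_sign v.
Proof.
by case: (F2_cases u) => ->; case: (F2_cases v) => ->;
  rewrite /F2_sign /= ?expr0 ?expr1 ?mulr1 ?mul1r // mulN1r opprK.
Qed.

Lemma F2_sign_nat (n : nat) : F2_sign n%:R = (-1) ^+ n.
Proof.
elim: n => [|n IHn]; first by rewrite /F2_sign expr0.
by rewrite mulrSr F2_signD IHn exprSr.
Qed.

Lemma F2_sign_inj : injective F2_sign.
Proof.
move=> u v; case: (F2_cases u) => ->; case: (F2_cases v) => -> //;
  rewrite /F2_sign /= expr0 expr1 => /eqP;
  by rewrite ?[1 == _]eq_sym eqNr oner_eq0.
Qed.

(** The casts reread vectors over ['Z_2] as vectors over the field ['F_2], where linear algebra is
    available. *)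
Definition form_sign (A : 'M['F_2]_3) (x y : Z2_3) : R :=
  F2_sign (((x : 'rV['F_2]_3) *m A *m (y : 'rV['F_2]_3)^T) 0 0).

Lemma form_sign_bicharacter A : bicharacter (form_sign A).
Proof.
split=> [x y|x y z|x y z]; rewrite /form_sign.
- by rewrite /F2_sign signr_eq0.
- by rewrite [(_ *m A)]mulmxDl mulmxDl [X in F2_sign X]mxE; exact: F2_signD.
- by rewrite linearD mulmxDr [X in F2_sign X]mxE; exact: F2_signD.
Qed.

Lemma form_sign_delta A i j :
  form_sign A (delta_mx 0 i) (delta_mx 0 j) = F2_sign (A i j).
Proof. by rewrite /form_sign trmx_delta -rowE -colE !mxE. Qed.

Lemma form_sign_inj A A' : form_sign A =2 form_sign A' -> A = A'.
Proof.
move=> E; apply/matrixP => i j; apply: F2_sign_inj.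
by rewrite -!form_sign_delta E.
Qed.

(** Pairing with the vectors [delta_mx 0 i] reads off coordinates, so the radicals are the kernels
    of [A] acting on rows and on columns. *)
Lemma form_sign_radicals A : A \in unitmx <->
  (forall y, (forall t, form_sign A y t = 1) -> y = 0) /\
  (forall t, (forall y, form_sign A y t = 1) -> t = 0).
Proof.
have sign1 u : F2_sign u = 1 -> u = 0.
  by move=> u1; apply: F2_sign_inj; rewrite u1 /F2_sign expr0.
split=> [Au|[rad _]].
  split=> y Hy.
    have yA0 : (y : 'rV['F_2]_3) *m A = 0.
      apply/rowP => j; rewrite [RHS]mxE; apply: sign1.
      by rewrite -(Hy (delta_mx 0 j)) /form_sign trmx_delta -colE [in RHS]mxE.
    by rewrite -[LHS](mulmxK Au) yA0 mul0mx.
  have Ay0 : A *m (y : 'rV['F_2]_3)^T = 0.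
    apply/colP => i; rewrite [RHS]mxE; apply: sign1.
    by rewrite -(Hy (delta_mx 0 i)) /form_sign -mulmxA -rowE [in RHS]mxE.
  by apply: trmx_inj; rewrite -[LHS](mulKmx Au) Ay0 mulmx0 trmx0.
rewrite -row_free_unit; apply: inj_row_free => y yA0.
by apply: rad => t; rewrite /form_sign yA0 mul0mx mxE /F2_sign expr0.
Qed.

Lemma Z2_3_addxx (x : Z2_3) : x + x = 0.
Proof.
apply/rowP => i; rewrite !mxE.
by case: (F2_cases (x 0 i)) => ->; apply: val_inj.
Qed.

Lemma character_ext (f g : Z2_3 -> R) :
  (forall x y, f (x + y) = f x * f y) -> (forall x y, g (x + y) = g x * g y) ->
  f 0 = 1 -> g 0 = 1 ->
  (forall i, f (delta_mx 0 i) = g (delta_mx 0 i)) -> f =1 g.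
Proof.
move=> fD gD f0 g0 E x; rewrite (row_sum_delta x).
rewrite (big_morph f fD f0) (big_morph g gD g0); apply: eq_bigr => i _.
case: (F2_cases (x 0 i)) => ->; last by rewrite !scale1r.
by rewrite !scale0r f0 g0.
Qed.

(** Since [x + x = 0], every value squares to 1 and is a sign; the signs on pairs of basis vectors
    form the matrix, and [character_ext] in each variable does the rest. *)
Lemma bicharacter_form (N : Z2_3 -> Z2_3 -> R) : bicharacter N ->
  exists A, N = form_sign A.
Proof.
move=> Nb; have [N0 Nl Nr] := Nb.
have Nsq x y : (N x y == 1) || (N x y == -1).
  by rewrite -sqrf_eq1 expr2 -Nl Z2_3_addxx (bicharacter0x _ Nb).
pose A : 'M['F_2]_3 :=
  \matrix_(i, j) (N (delta_mx 0 i) (delta_mx 0 j) != 1)%:R.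
have Fb := form_sign_bicharacter A; have [_ Fl Fr] := Fb.
exists A; apply/funext => x; apply/funext => y; move: x.
apply: character_ext => //.
- by rewrite (bicharacter0x _ Nb).
- by rewrite (bicharacter0x _ Fb).
move=> i; move: y; apply: character_ext => //.
- by rewrite (bicharacter0x _ (bicharacterC Nb)).
- by rewrite (bicharacter0x _ (bicharacterC Fb)).
move=> j; rewrite form_sign_delta mxE F2_sign_nat.
case/orP: (Nsq (delta_mx 0 i) (delta_mx 0 j)) => /eqP ->.
  by rewrite eqxx expr0.
by rewrite eqNr oner_eq0 expr1.
Qed.

Lemma azumaya_braidingP (B : Z2_3 -> Z2_3 -> R) :
  is_braiding (coboundary (octonion_cochain R)) B /\ azumaya B (octonions R) <->
  exists2 A, A \in unitmx &
    B = commutator_twist (octonion_cochain R) (form_sign A).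
Proof.
set F := octonion_cochain R; split=> [[Bb Ba]|[A Au ->]].
  have EB : B = commutator_twist F (fun x y => B x y / (F x y / F y x)).
    apply/funext => x; apply/funext => y.
    by rewrite /commutator_twist divfK // mulf_neq0 ?invr_neq0 ?cochain2_neq0.
  have Nb := Bb; rewrite EB in Nb; move/is_braiding_twist: Nb => Nb.
  have [A EN] := bicharacter_form Nb; rewrite EN in EB; exists A => //.
  apply/form_sign_radicals/(azumaya_twist F (form_sign_bicharacter A)).
  by rewrite -EB.
split; first exact/is_braiding_twist/form_sign_bicharacter.
apply/(azumaya_twist F (form_sign_bicharacter A)).
exact/form_sign_radicals.
Qed.

End Sign.

(** * Digit strings as matrices over ['F_2] *)

Lemma sum3 (V : nmodType) (f : 'I_3 -> V) : \sum_i f i = f i1 + f i2 + f i3.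
Proof.
rewrite !big_ord_recl big_ord0 addr0 addrA.
by congr (f _ + f _ + f _); apply: val_inj.
Qed.

(* The shift by [i != j] comes from [F x y / F y x], whose exponent has
   bilinear part [sum_(i <> j) x_i y_j]. *)
Definition string_mx (s : string) : 'M['F_2]_3 :=
  \matrix_(i, j) (string_coef s i j + (i != j))%:R.

Lemma form_sign_nat (R : realType) (a : 'I_3 -> 'I_3 -> nat) (x y : Z2_3) :
  form_sign R (\matrix_(i, j) (a i j)%:R) x y =
  (-1) ^+ (\sum_(i < 3) \sum_(j < 3) a i j * crd x i * crd y j)%N.
Proof.
rewrite -F2_sign_nat natr_sum /form_sign [in LHS]mxE; congr F2_sign.
under [RHS]eq_bigr do rewrite natr_sum.
rewrite [RHS]exchange_big; apply: eq_bigr => j _.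
rewrite [X in X * _]mxE mulr_suml; apply: eq_bigr => i _.
rewrite [(\matrix_(_, _) _) _ _]mxE [_^T _ _]mxE !natrM.
rewrite [X in X * _ = _]mulrC /crd.
by congr (_ * _ * _); rewrite -[LHS]natr_Zp.
Qed.

Lemma octonion_braiding_twist (R : realType) (s : string) :
  octonion_braiding R s =
  commutator_twist (octonion_cochain R) (form_sign R (string_mx s)).
Proof.
apply/funext => x; apply/funext => y.
rewrite /commutator_twist form_sign_nat /= /octonion_sign invr_sign -!exprD.
rewrite /octonion_braiding -signr_odd -[RHS]signr_odd.
congr (_ ^+ nat_of_bool _).
set a := string_coef s; set p := crd x; set q := crd y.
(* The terms [i <= j] of the two octonion exponents, together with the shift by [i != j], contain
   each [p i * q j] exactly twice, hence the doubled sum. *)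
have E : ((\sum_(i < 3) \sum_(j < 3) (a i j + (i != j)) * p i * q j) +
    (octonion_exponent x y + octonion_exponent y x) =
  braiding_exponent a x y + (\sum_(i < 3) \sum_(j < 3) p i * q j).*2)%N.
  rewrite /octonion_exponent /braiding_exponent -/p -/q.
  under [X in (_ + (_ + X + _))%N]eq_bigr do rewrite big_mkcond.
  under [X in (_ + (_ + (_ + X)))%N]eq_bigr do rewrite big_mkcond.
  rewrite -muln2 !(sum3 (V := nat)) /=.
  ring.
by rewrite E oddD odd_double addbF.
Qed.

(** Row by row, the order of the digits in a string, so that matrices and strings can be compared by
    computation. *)
Definition mx_bits (A : 'M['F_2]_3) : seq bool :=
  [seq A i j != 0 | i <- [:: i1; i2; i3], j <- [:: i1; i2; i3]].

(* [~~ eqn i j] is [i != j], in a form that reduces in [vm_compute]. *)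
Definition string_bits (s : string) : seq bool :=
  [seq odd (string_coef s i j + ~~ eqn i j) |
    i <- [:: i1; i2; i3], j <- [:: i1; i2; i3]].

Lemma mx_bits_inj : injective mx_bits.
Proof.
move=> A A' [] *; apply/matrixP => i j.
suff : (A i j != 0) = (A' i j != 0).
  by case: (F2_cases (A i j)) => ->; case: (F2_cases (A' i j)) => ->.
have I3 (k : 'I_3) : [\/ k = i1, k = i2 | k = i3].
  by case: k => [[|[|[|//]]] ik]; [apply: Or31|apply: Or32|apply: Or33];
    apply: val_inj.
by case: (I3 i) => ->; case: (I3 j) => ->.
Qed.

Lemma mx_bits_string (s : string) : mx_bits (string_mx s) = string_bits s.
Proof.
have bitE i j : (string_mx s i j != 0) = odd (string_coef s i j + ~~ eqn i j).
  rewrite mxE -[~~ eqn i j]/(i != j).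
  elim: (_ + _)%N => [|n IHn] //=.
  rewrite mulrSr -IHn; by case: (F2_cases n%:R) => ->.
by rewrite /mx_bits /= !bitE.
Qed.

(** * The invertible matrices match the listed strings *)

Lemma det_mx22 (K : comPzRingType) (A : 'M[K]_2) :
  \det A = A 0 0 * A 1 1 - A 0 1 * A 1 0.
Proof.
rewrite (expand_det_row _ 0) !big_ord_recl big_ord0 addr0.
rewrite /cofactor !det_mx11 !mxE expr0 expr1 mul1r mulN1r mulrN.
by congr (_ * A _ _ - A _ _ * A _ _); apply: val_inj.
Qed.

Lemma det_mx33 (K : comPzRingType) (A : 'M[K]_3) :
  \det A = A i1 i1 * (A i2 i2 * A i3 i3 - A i2 i3 * A i3 i2)
    - A i1 i2 * (A i2 i1 * A i3 i3 - A i2 i3 * A i3 i1)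
    + A i1 i3 * (A i2 i1 * A i3 i2 - A i2 i2 * A i3 i1).
Proof.
have L (i k : 'I_3) (j : 'I_2) : val (lift i j) = k -> lift i j = k.
  exact: val_inj.
rewrite (expand_det_row _ i1) sum3 /cofactor !det_mx22 !mxE.
rewrite !(L i1 i2 0 erefl) !(L i1 i3 1 erefl) !(L i2 i1 0 erefl)
  !(L i2 i3 1 erefl) !(L i3 i1 0 erefl) !(L i3 i2 1 erefl) /=.
rewrite expr0 expr1 sqrrN expr1n; ring.
Qed.

(** The expanded determinant depends only on nine entries in ['F_2], so each of the 512 cases is
    decided by evaluation. *)
Lemma unitmx_strings (A : 'M['F_2]_3) :
  (A \in unitmx) = (mx_bits A \in map string_bits azumaya_strings).
Proof.
rewrite unitmxE unitfE det_mx33.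
have -> : mx_bits A = [:: A i1 i1 != 0; A i1 i2 != 0; A i1 i3 != 0;
  A i2 i1 != 0; A i2 i2 != 0; A i2 i3 != 0;
  A i3 i1 != 0; A i3 i2 != 0; A i3 i3 != 0] by [].
move: (A i1 i1) (A i1 i2) (A i1 i3) (A i2 i1) (A i2 i2) (A i2 i3)
  (A i3 i1) (A i3 i2) (A i3 i3) => a b c d e f g h k.
by case: (F2_cases a) => ->; case: (F2_cases b) => ->; case: (F2_cases c) => ->;
  case: (F2_cases d) => ->; case: (F2_cases e) => ->; case: (F2_cases f) => ->;
  case: (F2_cases g) => ->; case: (F2_cases h) => ->; case: (F2_cases k) => ->;
  vm_compute.
Qed.

Lemma uniq_string_bits : uniq (map string_bits azumaya_strings).
Proof. by vm_compute. Qed.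

(** Links [List.In] on strings with the boolean membership of bit lists used in [unitmx_strings]. *)
Lemma mem_map_In (T : Type) (U : eqType) (f : T -> U) (l : seq T) (u : U) :
  u \in map f l <-> exists2 t, List.In t l & u = f t.
Proof.
elim: l => [|t l IHl]; first by split=> [//|[]].
rewrite in_cons; split=> [/orP[/eqP->|/IHl[t' lt' ->]]|[t' [->|lt'] ut]].
- by exists t; [left|].
- by exists t'; [right|].
- by rewrite ut eqxx.
- by apply/orP; right; apply/IHl; exists t'.
Qed.

Lemma In_nthP (T : Type) (t0 t : T) (l : seq T) :
  List.In t l <-> exists2 i, (i < size l)%N & t = nth t0 l i.
Proof.
elim: l => [|u l IHl]; first by split=> [//|[]].
split=> [[->|/IHl[i il ->]]|[[|i] il ti]].
- by exists 0%N.
- by exists i.+1.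
- by left; rewrite ti.
- by right; apply/IHl; exists i.
Qed.

(** Cancelling the nonzero factor [F x y / F y x] leaves [form_sign], which determines its
    matrix. *)
Lemma octonion_braiding_bits (R : realType) (s s' : string) :
  octonion_braiding R s = octonion_braiding R s' ->
  string_bits s = string_bits s'.
Proof.
rewrite !octonion_braiding_twist -!mx_bits_string => E.
congr mx_bits; apply: (@form_sign_inj R) => x y.
have F0 := cochain2_neq0 (octonion_cochain R).
have c0 : octonion_cochain R x y / octonion_cochain R y x != 0.
  by rewrite mulf_neq0 ?invr_neq0.
exact/(mulIf c0)/(congr1 (fun B => B x y) E).
Qed.

(** * The list of Azumaya braidings and their number *)

Local Open Scope classical_set_scope.
Local Open Scope card_scope.

Theorem theorem1p4 (R : realType) :
  let azumaya_braidings : set (Z2_3 -> Z2_3 -> R) :=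
    [set B | is_braiding (coboundary (octonion_cochain R)) B /\
             azumaya B (octonions R)] in
  azumaya_braidings #= `I_168 /\
  azumaya_braidings =
    [set B | exists2 s : string, List.In s azumaya_strings &
             forall x y : Z2_3, B x y = octonion_braiding R s x y].
Proof.
move=> azumaya_braidings.
have E : azumaya_braidings =
    [set B | exists2 s : string, List.In s azumaya_strings &
             forall x y : Z2_3, B x y = octonion_braiding R s x y].
  apply/seteqP; split=> B.
    case/azumaya_braidingP => A; rewrite unitmx_strings.
    case/mem_map_In => s ls; rewrite -mx_bits_string => /mx_bits_inj -> EB.
    by exists s => // x y; rewrite EB octonion_braiding_twist.
  case=> s ls EB; apply/azumaya_braidingP; exists (string_mx s).
    rewrite unitmx_strings; apply/mem_map_In.
    by exists s; rewrite ?mx_bits_string.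
  by rewrite -octonion_braiding_twist; apply/funext => x; apply/funext => y.
split=> //.
(* The default [EmptyString] is never reached, as indices stay below 168, the length of the list. *)
pose g i := octonion_braiding R (nth EmptyString azumaya_strings i).
have -> : azumaya_braidings = [set g i | i in `I_168].
  rewrite E; apply/seteqP; split=> B.
    case=> s /(In_nthP EmptyString)[i il ->] EB; exists i => //.
    by apply/funext => x; apply/funext => y; rewrite EB.
  case=> i il <-; exists (nth EmptyString azumaya_strings i) => //.
  by apply/(In_nthP EmptyString); exists i.
apply: inj_card_eq => i j /[!inE] il jl /octonion_braiding_bits.
(* Equal braidings have equal bit lists, and the bit lists of the strings are pairwise distinct, so
   the indices agree. *)
rewrite -!(nth_map _ [::] string_bits) // => /eqP.
by rewrite nth_uniq ?size_map ?uniq_string_bits // => /eqP.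
Qed.
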